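(* Let $n\geq 3$, let $t$ be an indeterminate, let $f(t)\in\mathbb{Z}[t^{\pm1}]$ be invertible, and let $\eta_2:T_n\rightarrow\mathrm{GL}_n(\mathbb{Z}[t^{\pm1}])$ be the representation of the twin group given by $\eta_2(s_i)=\left(\begin{array}{c|c|c} I_{i-1} & 0 & 0\\ \hline 0 & \begin{matrix}0 & f(t)\\ f(t)^{-1} & 0\end{matrix} & 0\\ \hline 0&0&I_{n-i-1}\end{array}\right)$ for $1\leq i\leq n-1$. Let $\hat{\eta}_2:WT_n\rightarrow\mathrm{GL}_n(\mathbb{Z}[t^{\pm1}])$ be a $2$-local representation of the welded twin group $WT_n$ that extends $\eta_2$ (i.e. $\hat\eta_2(s_i)=\eta_2(s_i)$ for all $i$). Then $\hat{\eta}_2$ is equivalent to the representation given, for $1\leq i\leq n-1$, by $$s_i\mapsto\left(\begin{array}{c|c|c} I_{i-1} & 0 & 0\\ \hline 0 & \begin{matrix}0 & f(t)\\ f(t)^{-1} & 0\end{matrix} & 0\\ \hline 0&0&I_{n-i-1}\end{array}\right),\qquad \rho_i\mapsto\left(\begin{array}{c|c|c} I_{i-1} & 0 & 0\\ \hline 0 & \begin{matrix}0 & g(t)\\ g(t)^{-1} & 0\end{matrix} & 0\\ \hline 0&0&I_{n-i-1}\end{array}\right),$$ where $g(t)\in\mathbb{Z}[t^{\pm1}]$ is invertible.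
   Context: The twin group $T_n$ has generators $s_1,\ldots,s_{n-1}$ and relations $s_i^2=1$ ($1\le i\le n-1$), $s_is_j=s_js_i$ ($|i-j|\geq2$). The welded twin group $WT_n$ has generators $s_1,\ldots,s_{n-1},\rho_1,\ldots,\rho_{n-1}$, with the relations of $T_n$ together with: $\rho_i\rho_{i+1}\rho_i=\rho_{i+1}\rho_i\rho_{i+1}$ ($1\le i\le n-2$); $\rho_i\rho_j=\rho_j\rho_i$ ($|i-j|\geq 2$); $\rho_i^2=1$ ($1\le i\le n-1$); $s_i\rho_j=\rho_js_i$ ($|i-j|\geq2$); $\rho_i\rho_{i+1}s_i=s_{i+1}\rho_i\rho_{i+1}$ ($1\le i\le n-2$); $\rho_is_{i+1}s_i=s_{i+1}s_i\rho_{i+1}$ ($1\le i\le n-2$). A representation $\theta:WT_n\to\mathrm{GL}_n(\mathbb{Z}[t^{\pm1}])$ is $2$-local if for each $1\leq i\leq n-1$ there are $M_i,N_i\in\mathrm{GL}_2(\mathbb{Z}[t^{\pm1}])$ with $\theta(s_i)=\mathrm{diag}(I_{i-1},M_i,I_{n-i-1})$ and $\theta(\rho_i)=\mathrm{diag}(I_{i-1},N_i,I_{n-i-1})$ (block diagonal). $I_r$ is the $r\times r$ identity matrix. Two representations $\theta,\theta'$ into $\mathrm{GL}_n(\mathbb{Z}[t^{\pm1}])$ are equivalent if there is $P\in\mathrm{GL}_n(\mathbb{Z}[t^{\pm1}])$ with $\theta'(x)=P^{-1}\theta(x)P$ for all group elements $x$. *)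

(* Defs.v *)
From HB Require Import structures.
From mathcomp Require Import all_boot all_order all_algebra.
From mathcomp Require Import fraction generic_quotient.
From mathcomp Require Import boolp.

Set Implicit Arguments.
Unset Strict Implicit.
Unset Printing Implicit Defensive.

Import GRing.Theory.
Local Open Scope ring_scope.
Local Open Scope quotient_scope.

(** Z[t, t^-1] is realized as the subring of Frac(Z[t]) made of the p / t^k;
    the indeterminate t is 'X. *)

Definition laurent_pred : {pred {fraction {poly int}}} :=
  fun x => `[< exists (k : nat) (p : {poly int}),
                 x * tofrac ('X ^+ k) = tofrac p >].

Lemma laurent_subring : subring_closed laurent_pred.
Proof.
split=> [|x y|x y]; rewrite !unfold_in /=.
- by apply/asboolP; exists 0, 1; rewrite expr0 mulr1.
- move=> /asboolP[k [p px]] /asboolP[l [q qy]]; apply/asboolP.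
  exists (k + l), (p * 'X ^+ l - q * 'X ^+ k).
  rewrite exprD !(tofracB, tofracM) -px -qy mulrBl; congr (_ - _).
    by rewrite mulrA.
  by rewrite mulrCA mulrC.
- move=> /asboolP[k [p px]] /asboolP[l [q qy]]; apply/asboolP.
  exists (k + l), (p * q).
  by rewrite exprD !tofracM -px -qy mulrACA.
Qed.

HB.instance Definition _ :=
  GRing.isSubringClosed.Build {fraction {poly int}} laurent_pred
    laurent_subring.

Record laurent :=
  Laurent { laurent_val : {fraction {poly int}};
            _ : laurent_val \in laurent_pred }.

HB.instance Definition _ := [isSub for laurent_val].
HB.instance Definition _ := [Choice of laurent by <:].
HB.instance Definition _ := [SubChoice_isSubComNzRing of laurent by <:].

Section FieldSubring.
Variables (F : fieldType) (S : pred F) (U : subComNzRingType S).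

Definition sub_unit : {pred U} := fun x => (x != 0) && ((val x)^-1 \in S).

Definition sub_inv (x : U) : U := insubd x (val x)^-1.

Lemma sub_mulVx : {in sub_unit, left_inverse 1 sub_inv *%R}.
Proof.
move=> x /andP[x0 xV]; apply: val_inj; rewrite rmorphM rmorph1.
have xVE : val (sub_inv x) = (val x)^-1 by exact: insubdK.
rewrite [X in X * _](xVE : _ = _) mulVf //.
by rewrite -(rmorph0 (val : U -> F)) (inj_eq val_inj).
Qed.

Lemma sub_unitPl (x y : U) : y * x = 1 -> sub_unit x.
Proof.
move=> yx; have vyx : val y * val x = 1 by rewrite -rmorphM yx rmorph1.
have x0 : val x != 0.
  by apply/eqP => x0; move/eqP: vyx; rewrite x0 mulr0 eq_sym oner_eq0.
apply/andP; split.
  by apply: contra_neq x0 => ->; rewrite rmorph0.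
by rewrite -[_^-1]mul1r -vyx mulfK //; apply: (valP y).
Qed.

Lemma sub_inv_out : {in [predC sub_unit], sub_inv =1 id}.
Proof.
move=> x; rewrite !unfold_in /= negb_and negbK => /orP[/eqP->|xV].
  by apply: val_inj; rewrite val_insubd rmorph0 invr0 if_same.
by apply: val_inj; rewrite val_insubd; move: xV; rewrite unfold_in => /negPf ->.
Qed.

Lemma sub_integral : GRing.integral_domain_axiom U.
Proof.
move=> x y /(congr1 val)/eqP; rewrite rmorphM rmorph0 mulf_eq0.
by rewrite -!(inj_eq val_inj) rmorph0.
Qed.

End FieldSubring.

HB.instance Definition _ :=
  GRing.ComNzRing_hasMulInverse.Build laurent
    (@sub_mulVx _ _ laurent) (@sub_unitPl _ _ laurent)
    (@sub_inv_out _ _ laurent).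

HB.instance Definition _ :=
  GRing.ComUnitRing_isIntegral.Build laurent (@sub_integral _ _ laurent).

Section GeneralLinear.
Variables (R : comUnitRingType) (n : nat).

Record GL := MkGL { GLmx :> 'M[R]_n; GL_unit : GLmx \in unitmx }.

HB.instance Definition _ := [isSub for GLmx].
HB.instance Definition _ := [Choice of GL by <:].

Definition GL_one : GL := MkGL (unitmx1 R n).

Lemma GL_inv_subproof (A : GL) : invmx A \in unitmx.
Proof. by rewrite unitmx_inv GL_unit. Qed.
Definition GL_inv (A : GL) : GL := MkGL (GL_inv_subproof A).

Lemma GL_mul_subproof (A B : GL) : A *m B \in unitmx.
Proof. by rewrite unitmx_mul !GL_unit. Qed.
Definition GL_mul (A B : GL) : GL := MkGL (GL_mul_subproof A B).

Lemma GL_mulA : associative GL_mul.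
Proof. by move=> A B C; apply: val_inj; apply: mulmxA. Qed.
Lemma GL_mul1 : left_id GL_one GL_mul.
Proof. by move=> A; apply: val_inj; apply: mul1mx. Qed.
Lemma GL_mulr1 : right_id GL_one GL_mul.
Proof. by move=> A; apply: val_inj; apply: mulmx1. Qed.
Lemma GL_mulV : left_inverse GL_one GL_inv GL_mul.
Proof. by move=> A; apply: val_inj; apply: mulVmx (GL_unit A). Qed.
Lemma GL_mulrV : right_inverse GL_one GL_inv GL_mul.
Proof. by move=> A; apply: val_inj; apply: mulmxV (GL_unit A). Qed.

HB.instance Definition _ :=
  isGroup.Build GL GL_mulA GL_mul1 GL_mulr1 GL_mulV GL_mulrV.

End GeneralLinear.

(* [(x, false)] stands for the generator x and [(x, true)] for its inverse. *)
Definition word (X : Type) := seq (X * bool).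

Section Presentation.
Variables (X : choiceType) (rel : word X -> word X -> Prop).

(* The least congruence on words containing [rel] and the free cancellations;
   [presented] below is the group < X | v = w for rel v w >. *)
Inductive pres_eq : word X -> word X -> Prop :=
| pres_refl w : pres_eq w w
| pres_sym v w : pres_eq v w -> pres_eq w v
| pres_trans u v w : pres_eq u v -> pres_eq v w -> pres_eq u w
| pres_cat v v' w w' :
    pres_eq v v' -> pres_eq w w' -> pres_eq (v ++ w) (v' ++ w')
| pres_cancel x b : pres_eq [:: (x, b); (x, ~~ b)] [::]
| pres_rel v w : rel v w -> pres_eq v w.

Definition pres_eqb (v w : word X) : bool := `[< pres_eq v w >].

Lemma pres_eqb_refl : reflexive pres_eqb.
Proof. by move=> w; apply/asboolP; apply: pres_refl. Qed.
Lemma pres_eqb_sym : symmetric pres_eqb.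
Proof. by move=> v w; apply/asboolP/asboolP; apply: pres_sym. Qed.
Lemma pres_eqb_trans : transitive pres_eqb.
Proof.
by move=> v u w /asboolP uv /asboolP vw; apply/asboolP; apply: pres_trans vw.
Qed.

Canonical pres_equiv := EquivRel pres_eqb
  pres_eqb_refl pres_eqb_sym pres_eqb_trans.

Definition presented := {eq_quot pres_equiv}.
HB.instance Definition _ : EqQuotient _ pres_equiv presented :=
  EqQuotient.on presented.
HB.instance Definition _ := Choice.on presented.

Lemma presentedP (v w : word X) :
  reflect (pres_eq v w) (\pi_presented v == \pi_presented w).
Proof. by rewrite piE; apply: asboolP. Qed.

Definition word_inv (w : word X) : word X :=
  rev [seq (l.1, ~~ l.2) | l <- w].

Lemma word_invK : involutive word_inv.
Proof.
move=> w; rewrite /word_inv map_rev revK -map_comp.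
by rewrite (eq_map (g := id)) ?map_id // => -[x b] /=; rewrite negbK.
Qed.

Lemma pres_mulV w : pres_eq (w ++ word_inv w) [::].
Proof.
elim: w => [|[x b] w IHw]; first exact: pres_refl.
have -> : ((x, b) :: w) ++ word_inv ((x, b) :: w) =
          [:: (x, b)] ++ ((w ++ word_inv w) ++ [:: (x, ~~ b)]).
  by rewrite /word_inv /= rev_cons -cats1 catA.
apply: (@pres_trans _ ([:: (x, b)] ++ ([::] ++ [:: (x, ~~ b)]))).
  apply: pres_cat (pres_refl _) _.
  exact: pres_cat IHw (pres_refl _).
exact: pres_cancel.
Qed.

Lemma pres_inv v w : pres_eq v w -> pres_eq (word_inv v) (word_inv w).
Proof.
move=> vw; apply: (@pres_trans _ (word_inv v ++ (w ++ word_inv w))).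
  rewrite -{1}[word_inv v]cats0; apply: pres_cat; first exact: pres_refl.
  exact/pres_sym/pres_mulV.
rewrite catA -[X in pres_eq _ X]cat0s; apply: pres_cat; last exact: pres_refl.
apply: (@pres_trans _ (word_inv v ++ v)).
  by apply: pres_cat; [exact: pres_refl | exact: pres_sym].
by rewrite -{2}[v]word_invK; apply: pres_mulV.
Qed.

Definition presented_one : presented := \pi_presented [::].
Definition presented_mul (x y : presented) : presented :=
  \pi_presented (repr x ++ repr y).
Definition presented_inv (x : presented) : presented :=
  \pi_presented (word_inv (repr x)).

Lemma repr_pi w : pres_eq (repr (\pi_presented w)) w.
Proof. by apply/presentedP; rewrite reprK. Qed.

Lemma presented_mulE v w :
  presented_mul (\pi_presented v) (\pi_presented w) = \pi_presented (v ++ w).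
Proof. by apply/eqP/presentedP/pres_cat; apply: repr_pi. Qed.

Lemma presented_invE w : presented_inv (\pi_presented w) = \pi_presented (word_inv w).
Proof. exact/eqP/presentedP/pres_inv/repr_pi. Qed.

Lemma presented_mulA : associative presented_mul.
Proof.
elim/quotW=> u; elim/quotW=> v; elim/quotW=> w.
by rewrite (presented_mulE v w) (presented_mulE u v) !presented_mulE catA.
Qed.
Lemma presented_mul1 : left_id presented_one presented_mul.
Proof. by elim/quotW=> w; rewrite presented_mulE. Qed.
Lemma presented_mulr1 : right_id presented_one presented_mul.
Proof. by elim/quotW=> w; rewrite presented_mulE cats0. Qed.
Lemma presented_mulrV :
  right_inverse presented_one presented_inv presented_mul.
Proof.
elim/quotW=> w; rewrite presented_invE presented_mulE.
exact/eqP/presentedP/pres_mulV.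
Qed.
Lemma presented_mulV :
  left_inverse presented_one presented_inv presented_mul.
Proof.
elim/quotW=> w; rewrite presented_invE presented_mulE.
by apply/eqP/presentedP; rewrite -{2}[w]word_invK; apply: pres_mulV.
Qed.

HB.instance Definition _ := isGroup.Build presented presented_mulA
  presented_mul1 presented_mulr1 presented_mulV presented_mulrV.

Definition pres_gen (x : X) : presented := \pi_presented [:: (x, false)].

End Presentation.

(** In what follows the generators are indexed from 0: [i : 'I_n.-1] is the
    index i + 1 of the usual numbering 1, ..., n - 1. *)

Definition far (i j : nat) : bool := (i.+1 < j)%N || (j.+1 < i)%N.

Inductive twin_rel (n : nat) : word 'I_n.-1 -> word 'I_n.-1 -> Prop :=
| twin_sq (i : 'I_n.-1) : twin_rel [:: (i, false); (i, false)] [::]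
| twin_far (i j : 'I_n.-1) : far i j ->
    twin_rel [:: (i, false); (j, false)] [:: (j, false); (i, false)].

Definition twin (n : nat) := presented (@twin_rel n).
HB.instance Definition _ n := Group.on (twin n).

Definition twin_s (n : nat) (i : 'I_n.-1) : twin n := pres_gen (@twin_rel n) i.

Definition wgen (n : nat) : choiceType := ('I_n.-1 + 'I_n.-1)%type.

Section WeldedTwin.
Variable n : nat.
Let s (i : 'I_n.-1) : wgen n * bool := (inl i, false).
Let r (i : 'I_n.-1) : wgen n * bool := (inr i, false).

Inductive wtwin_rel : word (wgen n) -> word (wgen n) -> Prop :=
| wtwin_s_sq (i : 'I_n.-1) : wtwin_rel [:: s i; s i] [::]
| wtwin_s_far (i j : 'I_n.-1) : far i j -> wtwin_rel [:: s i; s j] [:: s j; s i]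
| wtwin_r_braid (i j : 'I_n.-1) : j = i.+1 :> nat ->
    wtwin_rel [:: r i; r j; r i] [:: r j; r i; r j]
| wtwin_r_far (i j : 'I_n.-1) : far i j -> wtwin_rel [:: r i; r j] [:: r j; r i]
| wtwin_r_sq (i : 'I_n.-1) : wtwin_rel [:: r i; r i] [::]
| wtwin_sr_far (i j : 'I_n.-1) : far i j -> wtwin_rel [:: s i; r j] [:: r j; s i]
| wtwin_rrs (i j : 'I_n.-1) : j = i.+1 :> nat ->
    wtwin_rel [:: r i; r j; s i] [:: s j; r i; r j]
| wtwin_rss (i j : 'I_n.-1) : j = i.+1 :> nat ->
    wtwin_rel [:: r i; s j; s i] [:: s j; s i; r j].

Definition wtwin := presented wtwin_rel.
HB.instance Definition _ := Group.on wtwin.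

Definition wtwin_s (i : 'I_n.-1) : wtwin := pres_gen wtwin_rel (inl i).
Definition wtwin_rho (i : 'I_n.-1) : wtwin := pres_gen wtwin_rel (inr i).

End WeldedTwin.

Lemma local_dim n (i : 'I_n.-1) : (i + 2 + (n - i.+2) = n)%N.
Proof. by rewrite addn2 subnKC // -ltn_predRL. Qed.

Definition local_mx (R : pzRingType) n (i : 'I_n.-1) (M : 'M[R]_2) : 'M[R]_n :=
  castmx (local_dim i, local_dim i)
    (block_mx (block_mx (1%:M : 'M_i) 0 0 M) 0 0 (1%:M : 'M_(n - i.+2))).

Definition antidiag (R : unitRingType) (f : R) : 'M[R]_2 :=
  block_mx (0 : 'M_1) f%:M f^-1%:M 0.

(* A multiplicative map between groups preserves 1 and inverses, hence
   [{multiplicative G -> GL R n}] is the type of representations of G. *)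
Definition two_local (R : comUnitRingType) n
    (theta : {multiplicative wtwin n -> GL R n}) : Prop :=
  forall i : 'I_n.-1, exists M N : GL R 2,
    theta (wtwin_s i) = local_mx i M :> 'M_n
    /\ theta (wtwin_rho i) = local_mx i N :> 'M_n.

Definition equivalent (G : groupType) (R : comUnitRingType) n
    (theta theta' : {multiplicative G -> GL R n}) : Prop :=
  exists P : GL R n, forall x : G, theta' x = (P^-1 * theta x * P)%g.

(* Main.v *)
Require Import Defs.
From mathcomp Require Import all_boot all_order all_algebra.
From mathcomp Require Import generic_quotient.
From mathcomp Require Import zify.
Local Open Scope ring_scope.
Local Open Scope quotient_scope.

Set Implicit Arguments.
Unset Strict Implicit.
Unset Printing Implicit Defensive.

Import GRing.Theory.

(** Equivalence is in fact equality: the relations of the welded twin group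
    already force every 2-local extension of eta_2 to have the required form,
    so that the conjugating matrix can be taken to be the identity.

    Write N_i = (a b; c d) for the 2 x 2 block of the image of rho_i.
    - Once the blocks of the s_i are antidiagonal with the unit f, the product
      s_(i+1) s_i permutes the coordinates i, i+1, i+2 cyclically up to units,
      with the same unit f on i -> i+1 and on i+1 -> i+2.  The relation
      rho_i s_(i+1) s_i = s_(i+1) s_i rho_(i+1) says that conjugation by it
      carries N_i to N_(i+1); as the two units agree, the entries do not
      change, and all the blocks are equal
      ([rss_local_eq]).
    - One entry of rho_i rho_(i+1) s_i = s_(i+1) rho_i rho_(i+1) reads
      d a / f = 0, so d a = 0 ([rrs_corner_mul0]); this needs two consecutive
      indices, hence n >= 3.
    - rho_i^2 = 1 gives a^2 + b c = 1 = d^2 + c b.  Over an integral domain one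
      of a, d vanishes, hence b c = 1, hence both vanish, and the common block
      is antidiagonal with g = b ([involution_antidiag]).

    Relations are compared row by row, through the action of local matrices on
    basis row vectors. *)

(** * Rows of local matrices *)

Section LocalMatrices.
Variables (R : pzRingType) (n : nat).
Implicit Types (i : 'I_n.-1) (p q : 'I_n) (M : 'M[R]_2).

Lemma local_mxE i M p q :
  local_mx i M p q =
    if (i <= p < i.+2)%N && (i <= q < i.+2)%N
    then M (inord (p - i)) (inord (q - i)) else (p == q)%:R.
Proof.
rewrite /local_mx castmxE /= -(inj_eq (@cast_ord_inj _ _ (esym (local_dim i)))).
set p' := cast_ord _ p; set q' := cast_ord _ q.
(* The dimension cast does not change the value of an index. *)
have [-> ->] : p = p' :> nat /\ q = q' :> nat by [].
move: p' q' => p' q'; rewrite -val_eqE.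
case: (split_ordP p') => p1 ->; case: (split_ordP q') => q1 ->;
  rewrite ?(block_mxEul, block_mxEur, block_mxEdl, block_mxEdr);
  [case: (split_ordP p1) => {}p1 ->; case: (split_ordP q1) => {}q1 ->;
   rewrite ?(block_mxEul, block_mxEur, block_mxEdl, block_mxEdr)| | |].
all: have := ltn_ord p1; have := ltn_ord q1 => q1lt p1lt.
all: rewrite ?mxE /= -?val_eqE /=; case: ifP => ifb.
all: try by lia.
all: try by congr (nat_of_bool _)%:R; lia.
all: try by rewrite (_ : (_ == _) = false) //; lia.
by congr (M _ _); apply: val_inj; rewrite /= inordK; lia.
Qed.

(** The index is a natural number rather than an ordinal, so that i, i + 1 and
    i + 2 need no bound proofs; the vector is 0 out of range. *)
Definition basis_row (k : nat) : 'rV[R]_n := \row_j (j == k :> nat)%:R.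

Lemma basis_row_mul m (k : 'I_n) (A : 'M[R]_(n, m)) : basis_row k *m A = row k A.
Proof.
by rewrite rowE; congr (_ *m _); apply/rowP => j; rewrite !mxE.
Qed.

Lemma basis_row_local_out i M k :
  (k < i)%N || (i.+1 < k)%N -> basis_row k *m local_mx i M = basis_row k.
Proof.
move=> kout; have [ltkn|lenk] := ltnP k n.
  rewrite (basis_row_mul (Ordinal ltkn)); apply/rowP => q.
  rewrite mxE local_mxE !mxE ifF /=; last by lia.
  by rewrite -val_eqE eq_sym.
suff -> : basis_row k = 0 by rewrite mul0mx.
by apply/rowP => q; rewrite !mxE; case: eqP => // qk; have := ltn_ord q; lia.
Qed.

Lemma basis_row_local_in i M (k : 'I_2) :
  basis_row (i + k) *m local_mx i M =
    M k 0 *: basis_row i + M k 1 *: basis_row i.+1.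
Proof.
have ltik : (i + k < n)%N by have := ltn_ord i; have := ltn_ord k; lia.
rewrite (basis_row_mul (Ordinal ltik)); apply/rowP => q.
rewrite mxE local_mxE !mxE -val_eqE /=.
have kE : inord (i + k - i) = k by rewrite addKn inord_val.
have ltk := ltn_ord k.
have [qi|qi] := eqVneq (q : nat) i.
  rewrite ifT; last by lia.
  rewrite kE qi subnn (_ : inord 0 = 0); last by apply: val_inj; rewrite /= inordK.
  by rewrite (_ : (_ == _) = false) ?mulr1 ?mulr0 ?addr0 //; lia.
have [qi1|qi1] := eqVneq (q : nat) i.+1.
  rewrite ifT; last by lia.
  rewrite kE qi1 subSnn (_ : inord 1 = 1); last by apply: val_inj; rewrite /= inordK.
  by rewrite mulr1 mulr0 add0r.
rewrite ifF; last by lia.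
by rewrite (_ : (_ == _) = false) ?mulr0 ?addr0 //; lia.
Qed.

Lemma basis_row_local_fst i M :
  basis_row i *m local_mx i M =
    M 0 0 *: basis_row i + M 0 1 *: basis_row i.+1.
Proof. by rewrite -basis_row_local_in addn0. Qed.

Lemma basis_row_local_snd i M :
  basis_row i.+1 *m local_mx i M =
    M 1 0 *: basis_row i + M 1 1 *: basis_row i.+1.
Proof. by rewrite -basis_row_local_in addn1. Qed.

End LocalMatrices.

Lemma basis_row_pair_inj (R : pzRingType) n k (a b c d : R) :
  (k.+1 < n)%N ->
  a *: basis_row R n k + b *: basis_row R n k.+1 =
    c *: basis_row R n k + d *: basis_row R n k.+1 -> a = c /\ b = d.
Proof.
move=> ltkn eq_rows; have ltk : (k < n)%N by lia.
split.
  move/rowP/(_ (Ordinal ltk)): eq_rows.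
  by rewrite !mxE /= eqxx (ltn_eqF (ltnSn k)) !mulr1 !mulr0 !addr0.
move/rowP/(_ (Ordinal ltkn)): eq_rows.
by rewrite !mxE /= eqxx (gtn_eqF (ltnSn k)) !mulr1 !mulr0 !add0r.
Qed.

(** * Two by two matrices *)

Lemma antidiagE (R : unitRingType) (f : R) (k l : 'I_2) :
  antidiag f k l = if k == l then 0 else if k == 0 then f else f^-1.
Proof.
rewrite /antidiag.
case: (@split_ordP 1 1 k) => k1 ->; case: (@split_ordP 1 1 l) => l1 ->;
  rewrite ?(@block_mxEul R 1 1 1 1, @block_mxEur R 1 1 1 1,
            @block_mxEdl R 1 1 1 1, @block_mxEdr R 1 1 1 1) !mxE !ord1 //=.
Qed.

Lemma ord2_cases (k : 'I_2) : k = 0 \/ k = 1.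
Proof. by case: k => [[|[|//]] ?]; [left|right]; apply: val_inj. Qed.

Lemma mulmx2E (R : pzRingType) (M N : 'M[R]_2) k l :
  (M *m N) k l = M k 0 * N 0 l + M k 1 * N 1 l.
Proof.
rewrite mxE !big_ord_recl big_ord0 addr0 (_ : lift _ _ = 1) //.
exact: val_inj.
Qed.

(** The product d a must be assumed to vanish: an involution such as
    diag(1, -1) has no antidiagonal form. *)
Lemma involution_antidiag (R : idomainType) (N : 'M[R]_2) :
  N *m N = 1%:M -> N 1 1 * N 0 0 = 0 ->
  N 0 1 \is a GRing.unit /\ N = antidiag (N 0 1).
Proof.
move=> NN /eqP da0.
have NNE k l : N k 0 * N 0 l + N k 1 * N 1 l = (k == l)%:R.
  by rewrite -mulmx2E NN mxE.
have bc1 : N 0 1 * N 1 0 = 1.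
  move: da0; rewrite mulf_eq0 => /orP[]/eqP diag0.
    by have := NNE 1 1; rewrite eqxx diag0 mul0r addr0 mulrC.
  by have := NNE 0 0; rewrite eqxx diag0 mul0r add0r.
have a0 : N 0 0 = 0.
  have := NNE 0 0; rewrite eqxx bc1 => /(canRL (addrK _))/eqP.
  by rewrite subrr mulf_eq0 orbb => /eqP.
have d0 : N 1 1 = 0.
  have := NNE 1 1; rewrite eqxx mulrC bc1 => /(canRL (addKr _))/eqP.
  by rewrite addNr mulf_eq0 orbb => /eqP.
have bunit : N 0 1 \is a GRing.unit by apply/unitrPr; exists (N 1 0).
split=> //; apply/matrixP => k l; rewrite antidiagE.
have [->|->] := ord2_cases k; have [->|->] := ord2_cases l => //=.
by apply: (mulrI bunit); rewrite bc1 divrr.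
Qed.

(** * Relations between local matrices *)

Lemma local_mx_involution (R : pzRingType) n (i : 'I_n.-1) (N : 'M[R]_2) :
  local_mx i N *m local_mx i N = 1%:M -> N *m N = 1%:M.
Proof.
move=> NN; have lti : (i.+1 < n)%N by have := ltn_ord i; lia.
have row_id (k : 'I_2) : basis_row R n (i + k) =
    (1%:M : 'M_2) k 0 *: basis_row R n i + (1%:M : 'M_2) k 1 *: basis_row R n i.+1.
  by case: k => [[|[|//]] ?];
    rewrite !mxE /= ?addn0 ?addn1 scale1r scale0r ?addr0 ?add0r.
apply/matrixP => k l.
have := congr1 (mulmx (basis_row R n (i + k))) NN.
rewrite mulmxA mulmx1 basis_row_local_in mulmxDl -!scalemxAl.
rewrite basis_row_local_fst basis_row_local_snd {}row_id !scalerDr !scalerA.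
rewrite addrACA -!scalerDl => /(basis_row_pair_inj lti)[NN0 NN1].
by have [->|->] := ord2_cases l; rewrite mulmx2E.
Qed.

Section MixedRelations.
Variables (R : comUnitRingType) (n : nat) (f : R).
Hypothesis funit : f \is a GRing.unit.
Variables (i j : 'I_n.-1) (N N' : 'M[R]_2).
Hypothesis ij : j = i.+1 :> nat.

Let e := basis_row R n.
Let S := antidiag f.

Let lti2 : (i.+2 < n)%N.
Proof. by have := ltn_ord j; lia. Qed.

Let rows_i M : [/\ e i *m local_mx i M = M 0 0 *: e i + M 0 1 *: e i.+1,
    e i.+1 *m local_mx i M = M 1 0 *: e i + M 1 1 *: e i.+1 &
    e i.+2 *m local_mx i M = e i.+2].
Proof.
by rewrite basis_row_local_fst basis_row_local_snd basis_row_local_out; last lia.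
Qed.

Let rows_j M : [/\ e i *m local_mx j M = e i,
    e i.+1 *m local_mx j M = M 0 0 *: e i.+1 + M 0 1 *: e i.+2 &
    e i.+2 *m local_mx j M = M 1 0 *: e i.+1 + M 1 1 *: e i.+2].
Proof.
by rewrite -ij basis_row_local_fst basis_row_local_snd basis_row_local_out; last lia.
Qed.

Let rows_si : [/\ e i *m local_mx i S = f *: e i.+1,
    e i.+1 *m local_mx i S = f^-1 *: e i &
    e i.+2 *m local_mx i S = e i.+2].
Proof. by have := rows_i S; rewrite !antidiagE !scale0r addr0 add0r. Qed.

Let rows_sj : [/\ e i *m local_mx j S = e i,
    e i.+1 *m local_mx j S = f *: e i.+2 &
    e i.+2 *m local_mx j S = f^-1 *: e i.+1].
Proof. by have := rows_j S; rewrite !antidiagE !scale0r addr0 add0r. Qed.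

(** Both sides send rows i and i + 1 to combinations of rows i + 1 and i + 2,
    with the coefficients of N on the left and of N' on the right, all of them
    multiplied by the unit f. *)
Lemma rss_local_eq :
  local_mx i N *m local_mx j S *m local_mx i S =
    local_mx j S *m local_mx i S *m local_mx j N' -> N = N'.
Proof.
move=> rss.
have row0 := congr1 (mulmx (e i)) rss.
have row1 := congr1 (mulmx (e i.+1)) rss.
move: row0 row1; case: rows_si rows_sj (rows_i N) (rows_j N').
move=> si0 si1 si2 [sj0 sj1 sj2] [ni0 ni1 ni2] [nj0 nj1 nj2].
rewrite !mulmxA.
rewrite !(ni0, ni1, sj0, sj1, sj2, si0, si1, si2, nj1, nj2).
rewrite !(mulmxDl, =^~scalemxAl, si0, si2, sj0, sj1, nj1, nj2, scalerDr, scalerA).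
move=> /(basis_row_pair_inj lti2)[eq00 eq01].
move=> /(basis_row_pair_inj lti2)[eq10 eq11].
apply/matrixP => k l; apply: (mulrI funit); rewrite mulrC.
by case: k l => [[|[|//]] ?] [[|[|//]] ?];
  [move: eq00|move: eq01|move: eq10|move: eq11];
  congr (_ * _ = _ * _); congr (_ _ _); apply: val_inj.
Qed.

(** This is entry (i + 1, i) of the relation: on the left, the corner entry
    N 1 1 * N' 0 0 at (i + 1, i + 1) is moved to column i by s_i; on the right,
    row i + 1 is supported in the columns i + 1 and i + 2. *)
Lemma rrs_corner_mul0 :
  local_mx i N *m local_mx j N' *m local_mx i S =
    local_mx j S *m local_mx i N *m local_mx j N' -> N 1 1 * N' 0 0 = 0.
Proof.
move=> rrs.
have row1 := congr1 (mulmx (e i.+1)) rrs.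
move: row1; case: rows_si rows_sj (rows_i N) (rows_j N').
move=> si0 si1 si2 [sj0 sj1 sj2] [ni0 ni1 ni2] [nj0 nj1 nj2].
rewrite !mulmxA.
rewrite !(ni1, sj1, mulmxDl, =^~scalemxAl, ni2, nj0, nj1, nj2, si0, si1, si2, scalerDr, scalerA).
have lti : (i < n)%N by lia.
move=> /rowP/(_ (Ordinal lti)); rewrite !mxE /= eqxx.
rewrite (ltn_eqF (ltnSn i)) (ltn_eqF (leqnSn i.+1)).
rewrite !mulr0 !addr0 add0r mulr1 => eq0.
by rewrite -[LHS](mulrVK funit) eq0 mul0r.
Qed.
End MixedRelations.

(** * Representations of the welded twin group *)

Section WeldedRelations.
Variable n : nat.
Implicit Types i j : 'I_n.-1.

Let wtwin_pi_mul v w :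
  (\pi_(presented (@wtwin_rel n)) v * \pi_(presented (@wtwin_rel n)) w)%g =
  \pi_(presented (@wtwin_rel n)) (v ++ w).
Proof. exact: presented_mulE. Qed.

(* The explicit words keep unification from unfolding a product into the class
   of the canonical representatives of its factors. *)
Let gen_mul3 x y z :
  (pres_gen (@wtwin_rel n) x * pres_gen (@wtwin_rel n) y *
   pres_gen (@wtwin_rel n) z)%g =
  \pi_(presented (@wtwin_rel n)) [:: (x, false); (y, false); (z, false)].
Proof. by rewrite (wtwin_pi_mul [:: _] [:: _]) (wtwin_pi_mul [:: _; _]). Qed.

Lemma wtwin_rho_sqE i : (wtwin_rho i * wtwin_rho i = 1)%g.
Proof.
rewrite wtwin_pi_mul; exact/eqP/presentedP/pres_rel/wtwin_r_sq.
Qed.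

Lemma wtwin_rrsE i j : j = i.+1 :> nat ->
  (wtwin_rho i * wtwin_rho j * wtwin_s i =
   wtwin_s j * wtwin_rho i * wtwin_rho j)%g.
Proof.
by move=> ij; rewrite !gen_mul3; apply/eqP/presentedP/pres_rel; exact: wtwin_rrs.
Qed.

Lemma wtwin_rssE i j : j = i.+1 :> nat ->
  (wtwin_rho i * wtwin_s j * wtwin_s i =
   wtwin_s j * wtwin_s i * wtwin_rho j)%g.
Proof.
by move=> ij; rewrite !gen_mul3; apply/eqP/presentedP/pres_rel; exact: wtwin_rss.
Qed.

End WeldedRelations.

Lemma GLmxM (R : comUnitRingType) n (A B : GL R n) : GLmx (A * B)%g = A *m B.
Proof. by []. Qed.

(** Equality of all the blocks is what turns the product of corner entries of two
    neighbouring blocks into the condition d a = 0 on a single block. *)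
Lemma two_local_welded_antidiag (R : idomainType) n (f : R)
    (theta : {multiplicative wtwin n -> GL R n}) :
  (3 <= n)%N -> f \is a GRing.unit ->
  (forall i, theta (wtwin_s i) = local_mx i (antidiag f) :> 'M_n) ->
  two_local theta ->
  exists2 g : R, g \is a GRing.unit &
    forall i, theta (wtwin_rho i) = local_mx i (antidiag g) :> 'M_n.
Proof.
move=> n3 funit theta_s theta_local.
have lt0 : (0 < n.-1)%N by lia.
have lt1 : (1 < n.-1)%N by lia.
have [_ [N0 [_ theta_N0]]] := theta_local (Ordinal lt0).
have theta_rho k (i : 'I_n.-1) : i = k :> nat ->
    theta (wtwin_rho i) = local_mx i N0 :> 'M_n.
  elim: k i => [|k IHk] i ik.
    by rewrite (_ : i = Ordinal lt0) //; apply: val_inj.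
  have ltk : (k < n.-1)%N by have := ltn_ord i; lia.
  have [_ [N [_ theta_N]]] := theta_local i.
  have := congr1 (fun x => GLmx (theta x)) (@wtwin_rssE n (Ordinal ltk) i ik).
  rewrite !gmulfM !GLmxM !theta_s theta_N (IHk (Ordinal ltk)) //.
  by move/(@rss_local_eq _ _ _ funit (Ordinal ltk) i _ _ ik) => ->.
have NN : N0 *m N0 = 1%:M :> 'M[R]_2.
  apply: (@local_mx_involution _ _ (Ordinal lt0)).
  have := congr1 (fun x => GLmx (theta x)) (wtwin_rho_sqE (Ordinal lt0)).
  have -> : theta 1%g = 1%g by apply: (mulgI (theta 1%g)); rewrite -gmulfM !mulg1.
  by rewrite gmulfM GLmxM theta_N0.
have da0 : N0 1 1 * N0 0 0 = 0.
  have := congr1 (fun x => GLmx (theta x))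
    (@wtwin_rrsE n (Ordinal lt0) (Ordinal lt1) erefl).
  rewrite !gmulfM !GLmxM !theta_s !(theta_rho _ _ erefl).
  exact: rrs_corner_mul0.
have [gunit gE] := involution_antidiag NN da0.
by exists ((N0 : 'M_2) 0 1) => // i; rewrite (theta_rho _ _ erefl) {1}gE.
Qed.

Theorem theorem19 (n : nat) (f : laurent)
    (eta2 : {multiplicative twin n -> GL laurent n})
    (eta2hat : {multiplicative wtwin n -> GL laurent n}) :
  (3 <= n)%N ->
  f \is a GRing.unit ->
  (forall i : 'I_n.-1, eta2 (twin_s i) = local_mx i (antidiag f) :> 'M_n) ->
  two_local eta2hat ->
  (forall i : 'I_n.-1, eta2hat (wtwin_s i) = eta2 (twin_s i)) ->
  exists (g : laurent) (theta : {multiplicative wtwin n -> GL laurent n}),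
    [/\ g \is a GRing.unit,
        forall i : 'I_n.-1,
          theta (wtwin_s i) = local_mx i (antidiag f) :> 'M_n
          /\ theta (wtwin_rho i) = local_mx i (antidiag g) :> 'M_n
      & equivalent eta2hat theta].
Proof.
move=> n3 funit eta2E eta2hat_local eta2hat_s.
have theta_s i : eta2hat (wtwin_s i) = local_mx i (antidiag f) :> 'M_n.
  by rewrite eta2hat_s eta2E.
have [g gunit theta_rho] :=
  two_local_welded_antidiag n3 funit theta_s eta2hat_local.
exists g, eta2hat; split=> //; exists 1%g => x.
by rewrite invg1 mul1g mulg1.
Qed.
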